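(* Let $\Gamma$ be a local type environment and $\mathbb{G}$ a global type tree (balanced, well-formed and projectable onto every participant). If $\Gamma\sqsubseteq\mathbb{G}$ then $\Gamma$ is live.
   Context: Sorts are $\mathtt{int},\mathtt{bool},\mathtt{nat}$; subsorting $\le$ is the least reflexive relation with $\mathtt{nat}\le\mathtt{int}$. Local type trees are defined coinductively by $T ::= \mathtt{end} \mid \mathtt{p}\&\{\ell_i(S_i).T_i\}_{i\in I} \mid \mathtt{p}\oplus\{\ell_i(S_i).T_i\}_{i\in I}$ with $I$ finite nonempty and the $\ell_i$ distinct. Subtyping $\le$ on local types is the largest relation such that: $\mathtt{end}\le\mathtt{end}$; $\mathtt{p}\&\{\ell_i(S_i).T_i\}_{i\in I\cup J}\le \mathtt{p}\&\{\ell_i(S'_i).T'_i\}_{i\in I}$ if for all $i\in I$, $S'_i\le S_i$ and $T_i\le T'_i$; $\mathtt{p}\oplus\{\ell_i(S_i).T_i\}_{i\in I}\le \mathtt{p}\oplus\{\ell_i(S'_i).T'_i\}_{i\in I\cup J}$ if for all $i\in I$, $S_i\le S'_i$ and $T_i\le T'_i$. Global type trees are defined coinductively by $\mathbb{G} ::= \mathtt{end} \mid \mathtt{p}\to\mathtt{q}:\{\ell_i(S_i).\mathbb{G}_i\}_{i\in I}$ ($I$ finite nonempty). $\mathrm{pt}(\mathbb{G})$ is the least solution of $\mathrm{pt}(\mathtt{end})=\emptyset$, $\mathrm{pt}(\mathtt{p}\to\mathtt{q}:\{\ell_i(S_i).\mathbb{G}_i\}_{i\in I})=\{\mathtt{p},\mathtt{q}\}\cup\bigcup_i\mathrm{pt}(\mathbb{G}_i)$.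 Projection $\upharpoonright_{\mathtt{r}}$ is the largest relation between global and local type trees such that whenever $\mathbb{G}\upharpoonright_{\mathtt{r}}T$: if $\mathtt{r}\notin\mathrm{pt}(\mathbb{G})$ then $T=\mathtt{end}$; if $\mathbb{G}=\mathtt{p}\to\mathtt{r}:\{\ell_i(S_i).\mathbb{G}_i\}_{i\in I}$ then $T=\mathtt{p}\&\{\ell_i(S_i).T_i\}_{i\in I}$ with $\mathbb{G}_i\upharpoonright_{\mathtt{r}}T_i$; if $\mathbb{G}=\mathtt{r}\to\mathtt{q}:\{\ell_i(S_i).\mathbb{G}_i\}_{i\in I}$ then $T=\mathtt{q}\oplus\{\ell_i(S_i).T_i\}_{i\in I}$ with $\mathbb{G}_i\upharpoonright_{\mathtt{r}}T_i$; if $\mathbb{G}=\mathtt{p}\to\mathtt{q}:\{\ell_i(S_i).\mathbb{G}_i\}_{i\in I}$ with $\mathtt{r}\notin\{\mathtt{p},\mathtt{q}\}$ then $\mathbb{G}_i\upharpoonright_{\mathtt{r}}T$ for all $i$. Projection is functional; write $\mathbb{G}\upharpoonright\mathtt{r}$. $\mathbb{G}$ is balanced if for every subtree $\mathbb{G}'$ there is $k$ such that every $\mathtt{p}\in\mathrm{pt}(\mathbb{G}')$ occurs on every path from the root of $\mathbb{G}'$ of length at least $k$ or ending in $\mathtt{end}$. A local type environment $\Gamma$ is a finite map from participants to local type trees (compared by extensional equality); $\Gamma_1,\Gamma_2$ denotes union with disjoint domains. Environment transitions are the least relation with: $\mathtt{p}:\mathtt{q}\&\{\ell_i(S_i).T_i\}_{i\in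 I}\xrightarrow{\mathtt{p}:\mathtt{q}\&\ell_k(S_k)}\mathtt{p}:T_k$ and $\mathtt{p}:\mathtt{q}\oplus\{\ell_i(S_i).T_i\}_{i\in I}\xrightarrow{\mathtt{p}:\mathtt{q}\oplus\ell_k(S_k)}\mathtt{p}:T_k$ for $k\in I$; if $\Gamma\xrightarrow{\alpha}\Gamma'$ then $\Gamma,\mathtt{p}:T\xrightarrow{\alpha}\Gamma',\mathtt{p}:T$; if $\Gamma_1\xrightarrow{\mathtt{p}:\mathtt{q}\oplus\ell(S)}\Gamma_1'$, $\Gamma_2\xrightarrow{\mathtt{q}:\mathtt{p}\&\ell(S')}\Gamma_2'$ and $S\le S'$ then $\Gamma_1,\Gamma_2\xrightarrow{(\mathtt{p},\mathtt{q})\ell}\Gamma'_1,\Gamma'_2$. Write $\Gamma\xrightarrow{\alpha}$ if $\Gamma\xrightarrow{\alpha}\Gamma'$ for some $\Gamma'$; $\Gamma\to\Gamma'$ if $\Gamma\xrightarrow{(\mathtt{p},\mathtt{q})\ell}\Gamma'$ for some $\mathtt{p},\mathtt{q},\ell$; $\to^*$ is its reflexive transitive closure. Association: $\Gamma\sqsubseteq\mathbb{G}$ iff for all $\mathtt{p}\in\mathrm{pt}(\mathbb{G})$, $\mathtt{p}\in\mathrm{dom}(\Gamma)$ and $\Gamma(\mathtt{p})\le\mathbb{G}\upharpoonright\mathtt{p}$, and for all $\mathtt{p}\notin\mathrm{pt}(\mathbb{G})$, either $\mathtt{p}\notin\mathrm{dom}(\Gamma)$ or $\Gamma(\mathtt{p})=\mathtt{end}$.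 A reduction path is a finite or infinite sequence $\Gamma_0\xrightarrow{\lambda_0}\Gamma_1\xrightarrow{\lambda_1}\cdots$ where each $\lambda_i$ has the form $(\mathtt{p},\mathtt{q})\ell$; let $N$ be its set of valid indices. It is fair if for all $n\in N$, $\Gamma_n\xrightarrow{(\mathtt{p},\mathtt{q})\ell}$ implies there exist $k\ge n$ and $\ell'$ with $\lambda_k=(\mathtt{p},\mathtt{q})\ell'$. It is live if for all $n\in N$: $\Gamma_n\xrightarrow{\mathtt{p}:\mathtt{q}\oplus\ell(S)}$ implies there exist $k\in N$, $k\ge n$, and $\ell'$ with $\Gamma_k\xrightarrow{(\mathtt{p},\mathtt{q})\ell'}\Gamma_{k+1}$ being the $k$-th step of the path; and $\Gamma_n\xrightarrow{\mathtt{q}:\mathtt{p}\&\ell(S)}$ implies there exist $k\in N$, $k\ge n$, and $\ell'$ with $\Gamma_k\xrightarrow{(\mathtt{p},\mathtt{q})\ell'}\Gamma_{k+1}$ being the $k$-th step. An environment $\Gamma$ is live if whenever $\Gamma\to^*\Gamma'$, every fair path starting from $\Gamma'$ is live. *)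

(* Defs.v *)
From mathcomp Require Import all_boot finmap.
From Stdlib Require Import Relations.

Set Implicit Arguments.
Unset Strict Implicit.
Unset Printing Implicit Defensive.

Local Open Scope fset_scope.
Local Open Scope fmap_scope.

Inductive vsort : Type := sint | sbool | snat.

Inductive subsort : vsort -> vsort -> Prop :=
| subsort_refl S : subsort S S
| subsort_nat_int : subsort snat sint.

(* A family {l_i(S_i).X_i}_{i in I} with I finite and nonempty and the l_i
   distinct, indexed by its set of labels. *)
Record branches (lab : choiceType) (X : Type) : Type := Branches {
  bdom : {fset lab};
  bdom_neq0 : bdom != fset0;
  bfun : bdom -> vsort * X
}.

Definition bget (lab : choiceType) (X : Type) (B : branches lab X) (l : lab) :
  option (vsort * X) := omap (@bfun lab X B) (insub l).

(* [=] on these types is finer than bisimilarity.  This is harmless: subtyping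
   and projection are invariant under bisimilarity, and every transition of
   environments taken up to bisimilarity lifts to one on representatives, since
   transitions only replace a tree by one of its immediate subtrees. *)
CoInductive ltt (part lab : choiceType) : Type :=
| lend
| lrecv (p : part) (B : branches lab (ltt part lab))
| lsend (p : part) (B : branches lab (ltt part lab)).

CoInductive gtt (part lab : choiceType) : Type :=
| gend
| gcomm (p q : part) (B : branches lab (gtt part lab)).

Arguments lend {part lab}.
Arguments gend {part lab}.

Section Types.

Context {part lab : choiceType}.

Notation ltt := (ltt part lab).
Notation gtt := (gtt part lab).
Notation lbranches := (branches lab ltt).
Notation gbranches := (branches lab gtt).

Variant sub_rule (R : ltt -> ltt -> Prop) : ltt -> ltt -> Prop :=
| sub_end : sub_rule R lend lend
| sub_recv p (B B' : lbranches) :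
    (forall l S' T', bget B' l = Some (S', T') ->
       exists S T, [/\ bget B l = Some (S, T), subsort S' S & R T T']) ->
    sub_rule R (lrecv p B) (lrecv p B')
| sub_send p (B B' : lbranches) :
    (forall l S T, bget B l = Some (S, T) ->
       exists S' T', [/\ bget B' l = Some (S', T'), subsort S S' & R T T']) ->
    sub_rule R (lsend p B) (lsend p B').

Definition subtype (T T' : ltt) : Prop :=
  exists R : ltt -> ltt -> Prop,
    (forall U U', R U U' -> sub_rule R U U') /\ R T T'.

Inductive pt : gtt -> part -> Prop :=
| pt_sender p q B : pt (gcomm p q B) p
| pt_receiver p q B : pt (gcomm p q B) q
| pt_cont p q B l S G r :
    bget B l = Some (S, G) -> pt G r -> pt (gcomm p q B) r.

(* [gwalk G w G']: the word of labels [w] leads from the root of [G] to [G']. *)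
Inductive gwalk : gtt -> seq lab -> gtt -> Prop :=
| gwalk_nil G : gwalk G [::] G
| gwalk_cons p q B l S G w G' :
    bget B l = Some (S, G) -> gwalk G w G' -> gwalk (gcomm p q B) (l :: w) G'.

Definition gsubtree (G' G : gtt) : Prop := exists w, gwalk G w G'.

(* Finiteness, nonemptiness and distinctness of labels hold by construction;
   what remains of well-formedness is the absence of self-communication. *)
Definition wf_gtt (G : gtt) : Prop :=
  forall G', gsubtree G' G ->
    match G' with
    | gend => True
    | gcomm p q _ => p != q
    end.

Definition root_pt (G : gtt) (r : part) : Prop :=
  match G with
  | gend => False
  | gcomm p q _ => r = p \/ r = q
  end.

Definition occurs_on (G : gtt) (w : seq lab) (r : part) : Prop :=
  exists w1 w2 G1, [/\ w = w1 ++ w2, gwalk G w1 G1 & root_pt G1 r].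

Definition balanced (G : gtt) : Prop :=
  forall G', gsubtree G' G ->
    exists k : nat, forall r, pt G' r ->
      forall w H, gwalk G' w H -> k <= size w \/ H = gend -> occurs_on G' w r.

Definition proj_branches (R : gtt -> ltt -> Prop)
    (B : gbranches) (C : lbranches) : Prop :=
  bdom B = bdom C /\
  forall l S G, bget B l = Some (S, G) ->
    exists T, bget C l = Some (S, T) /\ R G T.

Definition proj_closed (r : part) (R : gtt -> ltt -> Prop) : Prop :=
  forall G T, R G T ->
    [/\ ~ pt G r -> T = lend,
        forall p B, G = gcomm p r B ->
          exists C, T = lrecv p C /\ proj_branches R B C,
        forall q B, G = gcomm r q B ->
          exists C, T = lsend q C /\ proj_branches R B C
      & forall p q B, G = gcomm p q B -> r <> p -> r <> q ->
          forall l S G', bget B l = Some (S, G') -> R G' T].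

Definition proj (r : part) (G : gtt) (T : ltt) : Prop :=
  exists R : gtt -> ltt -> Prop, proj_closed r R /\ R G T.

Definition projectable (G : gtt) : Prop := forall r, exists T, proj r G T.

Definition env : Type := {fmap part -> ltt}.

(* [arecv p q l S] is p:q&l(S), [asend p q l S] is p:q(+)l(S) and
   [acomm p q l] is (p,q)l. *)
Variant action : Type :=
| arecv (p q : part) (l : lab) (S : vsort)
| asend (p q : part) (l : lab) (S : vsort)
| acomm (p q : part) (l : lab).

Inductive step : env -> action -> env -> Prop :=
| step_recv p q B l S T :
    bget B l = Some (S, T) ->
    step [fmap].[p <- lrecv q B] (arecv p q l S) [fmap].[p <- T]
| step_send p q B l S T :
    bget B l = Some (S, T) ->
    step [fmap].[p <- lsend q B] (asend p q l S) [fmap].[p <- T]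
| step_frame Gam a Gam' p T :
    step Gam a Gam' -> p \notin domf Gam -> p \notin domf Gam' ->
    step Gam.[p <- T] a Gam'.[p <- T]
| step_comm Gam1 Gam1' Gam2 Gam2' p q l S S' :
    step Gam1 (asend p q l S) Gam1' ->
    step Gam2 (arecv q p l S') Gam2' ->
    subsort S S' ->
    fdisjoint (domf Gam1) (domf Gam2) ->
    fdisjoint (domf Gam1') (domf Gam2') ->
    step (Gam1 + Gam2) (acomm p q l) (Gam1' + Gam2').

Definition enabled (Gam : env) (a : action) : Prop :=
  exists Gam', step Gam a Gam'.

Definition red (Gam Gam' : env) : Prop :=
  exists p q l, step Gam (acomm p q l) Gam'.

Definition red_star : env -> env -> Prop := clos_refl_trans env red.

Definition assoc (Gam : env) (G : gtt) : Prop :=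
  (forall p, pt G p ->
     exists T U, [/\ Gam.[? p] = Some T, proj p G U & subtype T U]) /\
  (forall p, ~ pt G p -> Gam.[? p] = None \/ Gam.[? p] = Some lend).

(* [plen = Some m]: a path with m steps, hence states 0..m;
   [plen = None]: an infinite path.  The values of [pstate] and [plabel]
   outside the valid indices are irrelevant. *)
Record rpath : Type := RPath {
  plen : option nat;
  pstate : nat -> env;
  plabel : nat -> part * part * lab
}.

Definition valid_state (pi : rpath) (n : nat) : Prop :=
  if plen pi is Some m then n <= m else True.

Definition valid_step (pi : rpath) (n : nat) : Prop :=
  if plen pi is Some m then n < m else True.

Definition is_path (pi : rpath) : Prop :=
  forall n, valid_step pi n ->
    let: (p, q, l) := plabel pi n in
    step (pstate pi n) (acomm p q l) (pstate pi n.+1).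

Definition eventually_comm (pi : rpath) (n : nat) (p q : part) : Prop :=
  exists k l', [/\ n <= k, valid_step pi k & plabel pi k = (p, q, l')].

Definition fair_path (pi : rpath) : Prop :=
  forall n, valid_state pi n -> forall p q l,
    enabled (pstate pi n) (acomm p q l) -> eventually_comm pi n p q.

Definition live_path (pi : rpath) : Prop :=
  forall n, valid_state pi n -> forall p q l S,
    (enabled (pstate pi n) (asend p q l S) -> eventually_comm pi n p q) /\
    (enabled (pstate pi n) (arecv q p l S) -> eventually_comm pi n p q).

Definition live (Gam : env) : Prop :=
  forall Gam', red_star Gam Gam' ->
    forall pi, is_path pi -> pstate pi 0 = Gam' ->
      fair_path pi -> live_path pi.

End Types.

Arguments env : clear implicits.

(* Main.v *)
(** A communication (p, q) l of an environment associated with G is matched by a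
    reduction of G that fires the first p -> q node on every branch, possibly
    below nodes that involve neither p nor q; association survives this step.
    Of balance one only keeps that every participant of every subtree is met
    within a bounded distance on all branches.  This survives too: the
    continuations of a node not involving r all have the same projection on r,
    so r occurs in all of them or in none.

    Let r be about to send or receive, with distance at most d to its next
    occurrence.  If r is at the root, the awaited interaction is enabled and
    fairness fires it.  Otherwise fairness fires the root interaction; steps
    not involving r never increase the distance and firing the root decreases
    it, so induction on d concludes. *)

Require Import Defs.
From mathcomp Require Import all_boot finmap.
From Stdlib Require Import Classical.

Set Implicit Arguments.
Unset Strict Implicit.
Unset Printing Implicit Defensive.

Local Open Scope fset_scope.
Local Open Scope fmap_scope.

Lemma subsort_trans S1 S2 S3 : subsort S1 S2 -> subsort S2 S3 -> subsort S1 S3.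
Proof. by case=> // h23; inversion h23; constructor. Qed.

(** * Finite branch families: choice and common bounds *)

Section Branches.

Context {lab : choiceType} {X : Type}.
Implicit Type B : branches lab X.

Lemma bget_bdom B l x : bget B l = Some x -> l \in bdom B.
Proof. by rewrite /bget; case: insubP. Qed.

Lemma bdom_bget B l : l \in bdom B -> exists S x, bget B l = Some (S, x).
Proof.
move=> lB; rewrite /bget insubT /=.
by case: (bfun _) => S x; exists S, x.
Qed.

Lemma bget_val B (x : bdom B) : bget B (val x) = Some (bfun x).
Proof. by rewrite /bget valK. Qed.

Lemma branches_inhabited B : exists l S x, bget B l = Some (S, x).
Proof.
have /fset0Pn[l /bdom_bget[S [x Bl]]] := bdom_neq0 B.
by exists l, S, x.
Qed.

(** This assembles continuations chosen branch by branch into a single family with the same labels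
    and sorts; finiteness of the label set provides the choice. *)
Lemma fin_branches_choice B (P : lab -> vsort -> X -> X -> Prop) :
  (forall l S x, bget B l = Some (S, x) -> exists y, P l S x y) ->
  exists B', bdom B = bdom B' /\
    forall l S x S' x', bget B l = Some (S, x) -> bget B' l = Some (S', x') ->
      S = S' /\ P l S x x'.
Proof.
move=> exP.
have /fin_all_exists[f fP] (x : bdom B) :
    exists y, P (val x) (bfun x).1 (bfun x).2 y.
  by apply: exP; rewrite bget_val -surjective_pairing.
exists (Branches (bdom_neq0 B) (fun x => ((bfun x).1, f x))); split=> //.
move=> l S x S' x'; rewrite /bget /=; case: insubP => //= u _ <-.
by case=> e [<- <-]; have := fP u; rewrite e.
Qed.

(* Finiteness of the branching turns per-branch bounds into a common one. *)
Lemma branches_bound B (P : nat -> X -> Prop) :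
  (forall m n x, m <= n -> P m x -> P n x) ->
  (forall l S x, bget B l = Some (S, x) -> exists n, P n x) ->
  exists n, forall l S x, bget B l = Some (S, x) -> P n x.
Proof.
move=> Pmono exP.
have /fin_all_exists[f fP] (x : bdom B) : exists n, P n (bfun x).2.
  by apply: (exP (val x) (bfun x).1); rewrite bget_val -surjective_pairing.
exists (\max_x f x) => l S x; rewrite /bget; case: insubP => //= u _ _ [e].
have := fP u; rewrite e; apply: Pmono; exact: leq_bigmax.
Qed.

End Branches.

Lemma bget_transfer (lab : choiceType) (X Y : Type)
    (B : branches lab X) (B' : branches lab Y) l S x :
  bdom B = bdom B' -> bget B l = Some (S, x) ->
  exists S' y, bget B' l = Some (S', y).
Proof. by move=> e /bget_bdom; rewrite e => /bdom_bget. Qed.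

Section Liveness.

Context {part lab : choiceType}.
Notation ltt := (ltt part lab).
Notation gtt := (gtt part lab).
Notation env := (env part lab).
Implicit Types (p q r s : part) (l : lab) (G K : gtt) (T U : ltt) (Gam : env).

(** * Unfolding subtyping and projection *)

Lemma subtype_inv T U : subtype T U -> sub_rule subtype T U.
Proof.
case=> R [Rcl RTU].
have RS T' U' : R T' U' -> subtype T' U' by move=> h; exists R.
case: (Rcl _ _ RTU) => [|p B B' h|p B B' h]; constructor => l S V Bl.
- by have [S' [V' [? ? ?]]] := h _ _ _ Bl; exists S', V'; split=> //; exact: RS.
- by have [S' [V' [? ? ?]]] := h _ _ _ Bl; exists S', V'; split=> //; exact: RS.
Qed.

Lemma proj_branches_mono (R R' : gtt -> ltt -> Prop) B C :
  (forall G T, R G T -> R' G T) -> proj_branches R B C -> proj_branches R' B C.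
Proof.
move=> RR' [domE h]; split=> // l S G Bl.
by have [T [? ?]] := h _ _ _ Bl; exists T; split=> //; exact: RR'.
Qed.

(** Monotonicity of the projection clauses, which serves both to unfold [proj] and to reason by
    coinduction with candidates containing [proj]. *)
Lemma proj_closed_mono r (R R' : gtt -> ltt -> Prop) G T :
  proj_closed r R -> (forall G T, R G T -> R' G T) -> R G T ->
  [/\ ~ pt G r -> T = lend,
      forall p B, G = gcomm p r B ->
        exists C, T = lrecv p C /\ proj_branches R' B C,
      forall q B, G = gcomm r q B ->
        exists C, T = lsend q C /\ proj_branches R' B C
    & forall p q B, G = gcomm p q B -> r <> p -> r <> q ->
        forall l S G', bget B l = Some (S, G') -> R' G' T].
Proof.
move=> Rcl RR' /Rcl[h1 h2 h3 h4]; split=> //.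
- by move=> p B /h2[C [-> ?]]; exists C; split=> //; exact: proj_branches_mono RR' _.
- by move=> p B /h3[C [-> ?]]; exists C; split=> //; exact: proj_branches_mono RR' _.
- by move=> p q B e rp rq l S G' Bl; apply: RR'; exact: h4 e rp rq _ _ _ Bl.
Qed.

Lemma proj_inv r : proj_closed r (@proj part lab r).
Proof.
move=> G T [R [Rcl RGT]]; apply: (proj_closed_mono Rcl) RGT => G' T' h.
by exists R.
Qed.

Lemma proj_notin r G T : proj r G T -> ~ pt G r -> T = lend.
Proof. by move=> /proj_inv[]. Qed.

Lemma proj_receiver p r B T : proj r (gcomm p r B) T ->
  exists C, T = lrecv p C /\ proj_branches (proj r) B C.
Proof. by move=> /proj_inv[_ h _ _]; apply: h. Qed.

Lemma proj_sender r q B T : proj r (gcomm r q B) T ->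
  exists C, T = lsend q C /\ proj_branches (proj r) B C.
Proof. by move=> /proj_inv[_ _ h _]; apply: h. Qed.

Lemma proj_cont r p q B T l S K : proj r (gcomm p q B) T -> r <> p -> r <> q ->
  bget B l = Some (S, K) -> proj r K T.
Proof. by move=> /proj_inv[_ _ _ h] rp rq; apply: h. Qed.

(** Along the path to an occurrence of [r], nodes not involving [r] leave the projection unchanged,
    and the first one involving [r] makes it a send or a receive. *)
Lemma pt_proj_neq_lend r G T : pt G r -> proj r G T -> T <> lend.
Proof.
move=> Gr; elim: Gr T => {G r} [p q B|p q B|p q B l S G r Bl _ IH] T.
- by move=> /proj_sender[C [-> _]].
- by move=> /proj_receiver[C [-> _]].
have [->|/eqP rp] := eqVneq r p; first by move=> /proj_sender[C [-> _]].
have [->|/eqP rq] := eqVneq r q; first by move=> /proj_receiver[C [-> _]].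
by move=> /proj_cont h; exact: IH (h _ _ _ rp rq Bl).
Qed.

Lemma proj_neq_lend_pt r G T : proj r G T -> T <> lend -> pt G r.
Proof. by move=> GT T0; apply: NNPP => /(proj_notin GT). Qed.

(** * Balance as a bounded distance to the next occurrence *)

(** The bound [d] holds on all branches at once, and a branch that ends in [gend] before meeting [r]
    counts as a failure. *)
Fixpoint reaches (d : nat) (G : gtt) (r : part) : Prop :=
  root_pt G r \/
  match d, G with
  | d'.+1, gcomm _ _ B => forall l S K, bget B l = Some (S, K) -> reaches d' K r
  | _, _ => False
  end.

Lemma reaches_root d G r : root_pt G r -> reaches d G r.
Proof. by case: d => [|d]; left. Qed.

Lemma reaches_cont d p q B r l S K : reaches d (gcomm p q B) r ->
  r <> p -> r <> q -> bget B l = Some (S, K) ->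
  exists2 d', d = d'.+1 & reaches d' K r.
Proof.
by case: d => [|d] [[]|] // h _ _ Bl; exists d => //; exact: h Bl.
Qed.

Lemma reaches_mono r m n G : m <= n -> reaches m G r -> reaches n G r.
Proof.
elim: m n G => [|m IH] n G; first by move=> _ [h|//]; exact: reaches_root.
case: n => // n mn [h|]; first by left.
by case: G => // p q B h; right=> l S K Bl; apply: IH => //; exact: h Bl.
Qed.

(** In contrast with [balanced], the bound may depend on the participant. *)
Definition well_reaching G : Prop :=
  forall K r, gsubtree K G -> pt K r -> exists d, reaches d K r.

(** The empty word qualifies when the bound is 0 or the tree is [gend], so [r] must then be at the
    root. Otherwise, if [r] is not at the root, a word of a continuation prefixed with its label
    meets [r] inside that continuation. *)
Lemma occurs_reaches r k G :
  (forall w K, gwalk G w K -> k <= size w \/ K = gend -> occurs_on G w r) ->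
  reaches k G r.
Proof.
elim: k G => [|k IH] G occ.
  have [|w1 [w2 [K [e GK Kr]]]] := occ [::] G (gwalk_nil G); first by left.
  by case: w1 e GK => // _ GK; inversion GK; subst; left.
have [|Gr] := classic (root_pt G r); first by left.
case: G occ Gr => [|p q B] occ Gr.
  have [|w1 [w2 [K [e GK Kr]]]] := occ [::] _ (gwalk_nil _); first by right.
  by case: w1 e GK => // _ GK; inversion GK; subst.
right=> l S K Bl; apply: IH => w K' KK' endw.
have [|w1 [w2 [K1 [e GK1 K1r]]]] := occ (l :: w) K' (gwalk_cons _ _ Bl KK').
  by case: endw => [?|->]; [left|right].
case: w1 e GK1 => [|l' w1] e GK1; first by inversion GK1; subst.
case: e => ? ?; subst; inversion GK1; subst.
exists w1, w2, K1; split=> //; congruence.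
Qed.

Lemma balanced_well_reaching G : balanced G -> well_reaching G.
Proof.
move=> bal K r /bal[k hk] Kr; exists k.
by apply: occurs_reaches => w K'; exact: hk.
Qed.

(* The last two premises of [gstep_ctx] are kept separate so that the inductive
   is not nested. *)
Inductive gstep p q l : gtt -> gtt -> Prop :=
| gstep_root B S K : bget B l = Some (S, K) -> gstep p q l (gcomm p q B) K
| gstep_ctx r s B B' :
    r <> p -> r <> q -> s <> p -> s <> q -> bdom B = bdom B' ->
    (forall x S K S' K', bget B x = Some (S, K) -> bget B' x = Some (S', K') ->
       S = S') ->
    (forall x S K S' K', bget B x = Some (S, K) -> bget B' x = Some (S', K') ->
       gstep p q l K K') ->
    gstep p q l (gcomm r s B) (gcomm r s B').

(* How the local type of a participant evolves when (p, q) l fires. *)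
Variant lact p q l : part -> ltt -> ltt -> Prop :=
| lact_send C S T : bget C l = Some (S, T) -> lact p q l p (lsend q C) T
| lact_recv C S T : bget C l = Some (S, T) -> lact p q l q (lrecv p C) T
| lact_other r T : r <> p -> r <> q -> lact p q l r T T.

Lemma lactE p q l r T T' : r <> p -> r <> q -> lact p q l r T T' -> T' = T.
Proof. by move=> rp rq h; inversion h; subst. Qed.

(** * Global transitions: effect on projections and distances, and existence *)

Section GlobalStep.

Variables (p q : part) (l : lab).

Lemma pt_gstep r G G' : gstep p q l G G' -> pt G' r -> pt G r.
Proof.
elim=> {G G'} [B S K Bl Kr|a b B B' _ _ _ _ dE _ _ IH Kr]; first exact: pt_cont Bl Kr.
inversion Kr as [| |? ? ? x S' K' ? B'x K'r]; subst; [exact: pt_sender|exact: pt_receiver|].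
have [S [K Bx]] := bget_transfer (esym dE) B'x.
exact: pt_cont Bx (IH _ _ _ _ _ Bx B'x K'r).
Qed.

Lemma proj_root r B S K T T' : bget B l = Some (S, K) ->
  proj r (gcomm p q B) T -> lact p q l r T T' -> proj r K T'.
Proof.
move=> Bl pT h; inversion h as [C S' U Cl|C S' U Cl|r' U rp rq]; subst.
- have [C' [[?] [_ hC]]] := proj_sender pT; subst C'.
  by have [U [Cl' KU]] := hC _ _ _ Bl; move: Cl'; rewrite Cl => -[_ ->].
- have [C' [[?] [_ hC]]] := proj_receiver pT; subst C'.
  by have [U [Cl' KU]] := hC _ _ _ Bl; move: Cl'; rewrite Cl => -[_ ->].
- exact: proj_cont pT rp rq Bl.
Qed.

(** Context nodes survive in [G'], so they do not involve [r], and following one arbitrary branch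
    down to the fired node is enough. *)
Lemma gstep_notin r G G' T T' : gstep p q l G G' -> proj r G T ->
  lact p q l r T T' -> ~ pt G' r -> T' = lend.
Proof.
move=> GG'; elim: GG' T T' => {G G'}.
  by move=> B S K Bl T T' pT hT; exact: proj_notin (proj_root Bl pT hT).
move=> a b B B' _ _ _ _ dE _ _ IH T T' pT hT G'r.
have [x [S [K Bx]]] := branches_inhabited B.
have [S' [K' B'x]] := bget_transfer dE Bx.
have ra : r <> a by move=> e; apply: G'r; rewrite e; exact: pt_sender.
have rb : r <> b by move=> e; apply: G'r; rewrite e; exact: pt_receiver.
apply: (IH _ _ _ _ _ Bx B'x) hT _; first exact: proj_cont pT ra rb Bx.
by move=> K'r; apply: G'r; exact: pt_cont B'x K'r.
Qed.

(** Coinduction: the candidate [R] also relates the results of a step. A participant at the root of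
    a context node is neither [p] nor [q], hence keeps its type; at the fired node the projection
    moves to the continuation. *)
Lemma proj_gstep r G G' T T' : gstep p q l G G' -> proj r G T ->
  lact p q l r T T' -> proj r G' T'.
Proof.
pose R K U := proj r K U \/
  exists K0 U0, [/\ gstep p q l K0 K, proj r K0 U0 & lact p q l r U0 U].
suff Rcl : proj_closed r R.
  by move=> ? ? ?; exists R; split=> //; right; exists G, T.
have projR K U : proj r K U -> R K U by left.
move=> K U [KU|[K0 [U0 [K0K K0U0 U0U]]]].
  exact: proj_closed_mono (@proj_inv r) projR KU.
inversion K0K as [B S K1 Bl e1 e2|a b B B' ap aq bp bq dE hS hst e1 e2]; subst.
  apply: (proj_closed_mono (@proj_inv r) projR).
  exact: proj_root Bl K0U0 U0U.
have hC C : r <> p -> r <> q -> proj_branches (proj r) B C -> proj_branches R B' C.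
  move=> rp rq [dBC h]; split; first by rewrite -dE.
  move=> x S' K' B'x; have [S [K Bx]] := bget_transfer (esym dE) B'x.
  have [V [Cx KV]] := h _ _ _ Bx; exists V.
  rewrite -(hS _ _ _ _ _ Bx B'x); split=> //; right; exists K, V.
  by split=> //; [exact: hst Bx B'x|exact: lact_other].
split; first exact: gstep_notin K0K K0U0 U0U.
- move=> c B0 [? ? ?]; subst c b B0.
  rewrite (lactE bp bq U0U); have [C [-> ?]] := proj_receiver K0U0.
  by exists C; split=> //; exact: hC.
- move=> c B0 [? ? ?]; subst c a B0.
  rewrite (lactE ap aq U0U); have [C [-> ?]] := proj_sender K0U0.
  by exists C; split=> //; exact: hC.
- move=> c d B0 [? ? ?] rc rd x S' K' B'x; subst c d B0.
  have [S [K Bx]] := bget_transfer (esym dE) B'x.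
  right; exists K, U0; split=> //; first exact: hst Bx B'x.
  exact: proj_cont K0U0 rc rd Bx.
Qed.

(** A step only removes [p -> q] nodes, none of which involves [r]. *)
Lemma reaches_gstep d r G G' : r <> p -> r <> q -> gstep p q l G G' ->
  reaches d G r -> reaches d G' r.
Proof.
move=> rp rq GG'; elim: GG' d => {G G'} [B S K Bl|a b B B' _ _ _ _ dE _ _ IH] d.
  move=> /reaches_cont-/(_ _ _ _ rp rq Bl)[d' ->].
  exact: reaches_mono.
case: d => [|d] [h|h] //; [by left|by left|right].
move=> x S' K' B'x; have [S [K Bx]] := bget_transfer (esym dE) B'x.
exact: IH Bx B'x _ (h _ _ _ Bx).
Qed.

Lemma gsubtree_cont a b B x S K G : bget B x = Some (S, K) ->
  gsubtree G K -> gsubtree G (gcomm a b B : gtt).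
Proof. by move=> Bx [w Kw]; exists (x :: w); exact: gwalk_cons Bx Kw. Qed.

Lemma gsubtree_refl G : gsubtree G G.
Proof. by exists [::]; exact: gwalk_nil. Qed.

Lemma well_reaching_cont a b B x S K : bget B x = Some (S, K) ->
  well_reaching (gcomm a b B) -> well_reaching K.
Proof. by move=> Bx wG K' r K'K; apply: wG; exact: gsubtree_cont Bx K'K. Qed.

(* All continuations of a context node have the same projection on r, so r
   occurs in all of them as soon as it occurs in one. *)
Lemma gstep_reaches r G G' T T' : gstep p q l G G' -> well_reaching G ->
  proj r G T -> lact p q l r T T' -> pt G' r -> exists d, reaches d G' r.
Proof.
move=> GG'; elim: GG' T T' => {G G'} [B S K Bl|a b B B' ap aq bp bq dE hS hst IH] T T'.
  move=> wG _ _; apply: wG; exact: gsubtree_cont Bl (gsubtree_refl K).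
move=> wG pT hT G'r.
have pT' := proj_gstep (gstep_ctx ap aq bp bq dE hS hst) pT hT.
have T'0 := pt_proj_neq_lend G'r pT'.
have [->|/eqP ra] := eqVneq r a; first by exists 0; left; left.
have [->|/eqP rb] := eqVneq r b; first by exists 0; left; right.
have [|d hd] := @branches_bound _ _ B' (fun d K => reaches d K r)
    (@reaches_mono r).
  move=> x S' K' B'x; have [S [K Bx]] := bget_transfer (esym dE) B'x.
  apply: (IH _ _ _ _ _ Bx B'x T T') => //.
  - exact: well_reaching_cont Bx wG.
  - exact: proj_cont pT ra rb Bx.
  - exact: proj_neq_lend_pt (proj_cont pT' ra rb B'x) T'0.
by exists d.+1; right.
Qed.

(** Either the walk passes a fired node and ends in an old subtree, or it stays in the context.
    There it meets only nodes without [p] and [q], so the projections of [G] on these two are also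
    projections of [K]. *)
Lemma gwalk_gstep w G G' K' : gstep p q l G G' -> gwalk G' w K' ->
  gsubtree K' G \/
  exists K, [/\ gsubtree K G, gstep p q l K K' &
    forall r T, r = p \/ r = q -> proj r G T -> proj r K T].
Proof.
move=> GG'; elim: GG' w => {G G'} [B S K Bl|a b B B' ap aq bp bq dE hS hst IH] w wK'.
  by left; apply: gsubtree_cont Bl _; exists w.
inversion wK' as [|? ? ? x S' K1 w' ? B'x K1K']; subst.
  right; exists (gcomm a b B); split=> //; first exact: gsubtree_refl.
  exact: gstep_ctx.
have [S [K Bx]] := bget_transfer (esym dE) B'x.
have [KK'|[K0 [K0K K0K' hp]]] := IH _ _ _ _ _ Bx B'x _ K1K'.
  by left; exact: gsubtree_cont Bx KK'.
right; exists K0; split=> //; first exact: gsubtree_cont Bx K0K.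
move=> r T rpq pT; apply: hp => //.
by apply: proj_cont pT _ _ Bx; case: rpq => ->; apply: not_eq_sym.
Qed.

Lemma gsubtree_proj K G r : gsubtree K G -> projectable G ->
  exists T, proj r K T.
Proof.
case=> w; elim=> {w G K} [|a b B x S K w K' Bx _ IH] // hG.
apply: IH => r'; have [T pT] := hG r'.
have [?|/eqP ra] := eqVneq r' a.
  subst r'; have [C [_ [_ hC]]] := proj_sender pT.
  by have [U [_ ?]] := hC _ _ _ Bx; exists U.
have [?|/eqP rb] := eqVneq r' b.
  subst r'; have [C [_ [_ hC]]] := proj_receiver pT.
  by have [U [_ ?]] := hC _ _ _ Bx; exists U.
by exists T; exact: proj_cont pT ra rb Bx.
Qed.

(** For a subtree of [G'] that is itself the result of a step, [gstep_reaches] needs a projection of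
    its source: for [p] and [q] it is the one of [G], and for the others any projection will do, as
    the step leaves it unchanged. *)
Lemma well_reaching_gstep G G' Tp Tp' Tq Tq' : gstep p q l G G' ->
  projectable G -> well_reaching G ->
  proj p G Tp -> lact p q l p Tp Tp' -> proj q G Tq -> lact p q l q Tq Tq' ->
  well_reaching G'.
Proof.
move=> GG' prG wG pTp hTp pTq hTq K' r [w G'K'] K'r.
have [K'G|[K [KG KK' hK]]] := gwalk_gstep GG' G'K'; first exact: wG.
have wK : well_reaching K.
  move=> K1 r1 [w1 w1P]; apply: wG; have [w2 w2P] := KG.
  exists (w2 ++ w1); elim: w2P w1P => //= *; apply: gwalk_cons; eauto.
have [?|/eqP rp] := eqVneq r p.
  by subst r; apply: gstep_reaches KK' wK _ hTp K'r; apply: hK => //; left.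
have [?|/eqP rq] := eqVneq r q.
  by subst r; apply: gstep_reaches KK' wK _ hTq K'r; apply: hK => //; right.
have [T pT] := gsubtree_proj r KG prG.
exact: gstep_reaches KK' wK pT (lact_other _ _ rp rq) K'r.
Qed.

(** Any other root involving [p] or [q] would give one of them a projection with the wrong direction
    or partner. *)
Lemma head_comm a b (B : branches lab gtt) C C' : proj p (gcomm a b B) (lsend q C) ->
  proj q (gcomm a b B) (lrecv p C') ->
  (a = p /\ b = q) \/ [/\ a <> p, a <> q, b <> p & b <> q].
Proof.
move=> pG qG.
have [?|/eqP ap] := eqVneq a p.
  by subst a; have [? [[]]] := proj_sender pG; left.
have [?|/eqP bp] := eqVneq b p.
  by subst b; have [? []] := proj_receiver pG.
have [?|/eqP aq] := eqVneq a q.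
  by subst a; have [? []] := proj_sender qG.
have [?|/eqP bq] := eqVneq b q; last by right.
by subst b; have [? [[? _] _]] := proj_receiver qG; case: ap.
Qed.

(** Induction on the distance to [p]. All continuations of a context node have the same projection
    on [p], so [l] is available in each of them; the steps found there are assembled by finite
    choice. *)
Lemma gstep_exists d G C C' S U : reaches d G p ->
  proj p G (lsend q C) -> proj q G (lrecv p C') -> bget C l = Some (S, U) ->
  exists G', gstep p q l G G'.
Proof.
move=> + + + /bget_bdom Cl {S U}.
elim: d G => [|d IH] [|a b B] dG pG qG; try by case: dG => [[]|].
  have [[? ?]|[ap aq bp bq]] := head_comm pG qG; last by case: dG => -[]; congruence.
  subst a b; have [C0 [[?] [dE _]]] := proj_sender pG; subst C0.
  by move: Cl; rewrite -dE => /bdom_bget[S [K Bl]]; exists K; exact: gstep_root Bl.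
have [[? ?]|[ap aq bp bq]] := head_comm pG qG.
  subst a b; have [C0 [[?] [dE _]]] := proj_sender pG; subst C0.
  by move: Cl; rewrite -dE => /bdom_bget[S [K Bl]]; exists K; exact: gstep_root Bl.
have /fin_branches_choice[B' [dE hB']] x S K :
    bget B x = Some (S, K) -> exists K', gstep p q l K K'.
  move=> Bx; apply: IH.
  - have [] := reaches_cont dG _ _ Bx; [exact: not_eq_sym|exact: not_eq_sym|].
    by move=> d' [->].
  - by apply: proj_cont pG _ _ Bx; apply: not_eq_sym.
  - by apply: proj_cont qG _ _ Bx; apply: not_eq_sym.
exists (gcomm a b B'); apply: gstep_ctx => // x S K S' K' Bx B'x.
  by have [] := hB' _ _ _ _ _ Bx B'x.
by have [] := hB' _ _ _ _ _ Bx B'x.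
Qed.

(** Subtyping lets a receiver accept more labels than its projection lists, so that [l] is listed
    has to be read off the fired node, reached along any branch. *)
Lemma gstep_recv_label G G' C : gstep p q l G G' -> proj q G (lrecv p C) ->
  l \in bdom C.
Proof.
elim=> {G G'} [B S K Bl qC|a b B B' ap aq bp bq dE _ _ IH qC].
  by have [C' [[<-] [<- _]]] := proj_receiver qC; exact: bget_bdom Bl.
have [x [S [K Bx]]] := branches_inhabited B.
have [S' [K' B'x]] := bget_transfer dE Bx.
by apply: (IH _ _ _ _ _ Bx B'x); apply: proj_cont qC _ _ Bx; apply: not_eq_sym.
Qed.

End GlobalStep.

(** * Environment transitions described by lookups *)

Lemma step_send_inv Gam a Gam' p q l S : step Gam a Gam' -> a = asend p q l S ->
  exists B T, [/\ Gam.[? p] = Some (lsend q B), bget B l = Some (S, T) &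
    forall r, Gam'.[? r] = if r == p then Some T else Gam.[? r]].
Proof.
elim=> {Gam a Gam'} //.
  move=> p' q' B l' S' T Bl [? ? ? ?]; subst; exists B, T.
  by split=> // [|r]; rewrite !fnd_set ?eqxx // fnd_fmap0; case: eqP.
move=> Gam a Gam' p' T _ IH pG pG' /IH[B [U [Gp Bl hG']]]; exists B, U.
have pp' : p == p' = false.
  by apply/negP => /eqP e; move: pG; rewrite -e -fndSome Gp.
split=> // [|r]; rewrite !fnd_set ?pp' // hG'.
by case: (r =P p) => // ->; rewrite pp'.
Qed.

Lemma step_recv_inv Gam a Gam' p q l S : step Gam a Gam' -> a = arecv p q l S ->
  exists B T, [/\ Gam.[? p] = Some (lrecv q B), bget B l = Some (S, T) &
    forall r, Gam'.[? r] = if r == p then Some T else Gam.[? r]].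
Proof.
elim=> {Gam a Gam'} //.
  move=> p' q' B l' S' T Bl [? ? ? ?]; subst; exists B, T.
  by split=> // [|r]; rewrite !fnd_set ?eqxx // fnd_fmap0; case: eqP.
move=> Gam a Gam' p' T _ IH pG pG' /IH[B [U [Gp Bl hG']]]; exists B, U.
have pp' : p == p' = false.
  by apply/negP => /eqP e; move: pG; rewrite -e -fndSome Gp.
split=> // [|r]; rewrite !fnd_set ?pp' // hG'.
by case: (r =P p) => // ->; rewrite pp'.
Qed.

Lemma step_comm_inv Gam a Gam' p q l : step Gam a Gam' -> a = acomm p q l ->
  exists B1 B2 S1 S2 T1 T2, [/\ p <> q,
    Gam.[? p] = Some (lsend q B1) /\ bget B1 l = Some (S1, T1),
    Gam.[? q] = Some (lrecv p B2) /\ bget B2 l = Some (S2, T2),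
    subsort S1 S2 &
    [/\ Gam'.[? p] = Some T1, Gam'.[? q] = Some T2 &
      forall r, r <> p -> r <> q -> Gam'.[? r] = Gam.[? r]]].
Proof.
elim=> {Gam a Gam'} //.
  move=> Gam a Gam' p' T _ IH pG pG'.
  move=> /IH[B1 [B2 [S1 [S2 [T1 [T2 [pq [Gp B1l] [Gq B2l] S12 [G'p G'q hG']]]]]]]].
  have pp' : p == p' = false.
    by apply/negP => /eqP e; move: pG; rewrite -e -fndSome Gp.
  have qp' : q == p' = false.
    by apply/negP => /eqP e; move: pG; rewrite -e -fndSome Gq.
  exists B1, B2, S1, S2, T1, T2.
  split=> //; rewrite !fnd_set ?pp' ?qp' //; split=> // r rp rq.
  by rewrite !fnd_set hG'.
move=> Gam1 Gam1' Gam2 Gam2' p' q' l' S S' st1 _ st2 _ SS' dis dis' [? ? ?]; subst.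
have [B1 [T1 [Gp B1l hG1]]] := step_send_inv st1 erefl.
have [B2 [T2 [Gq B2l hG2]]] := step_recv_inv st2 erefl.
have p1 : p \in domf Gam1 by rewrite -fndSome Gp.
have q2 : q \in domf Gam2 by rewrite -fndSome Gq.
have p2 := fdisjointP dis _ p1.
have p1' : p \in domf Gam1' by rewrite -fndSome hG1 eqxx.
have q2' : q \in domf Gam2' by rewrite -fndSome hG2 eqxx.
have p2' := fdisjointP dis' _ p1'.
exists B1, B2, S, S', T1, T2; split=> //.
- by move=> e; move: p2; rewrite e q2.
- by rewrite fnd_cat (negPf p2).
- by rewrite fnd_cat q2.
- split; first by rewrite fnd_cat (negPf p2') hG1 eqxx.
    by rewrite fnd_cat q2' hG2 eqxx.
  move=> r /eqP/negPf rp /eqP/negPf rq; rewrite !fnd_cat -!fndSome hG1 hG2 rp rq.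
  by case: ifP.
Qed.

(** Framing removes the other participants one at a time, until only [p] and [q] remain and
    [step_comm] applies. *)
Lemma step_comm_enabled Gam p q l B1 B2 S1 S2 T1 T2 : p <> q ->
  Gam.[? p] = Some (lsend q B1) -> bget B1 l = Some (S1, T1) ->
  Gam.[? q] = Some (lrecv p B2) -> bget B2 l = Some (S2, T2) ->
  subsort S1 S2 -> enabled Gam (acomm p q l).
Proof.
move=> pq + B1l + B2l S12.
(* Preservation of the domain is added to obtain the freshness condition of [step_frame] on the
   target. *)
suff H n : #|` domf Gam| <= n ->
    Gam.[? p] = Some (lsend q B1) -> Gam.[? q] = Some (lrecv p B2) ->
    exists Gam', step Gam (acomm p q l) Gam' /\ domf Gam' = domf Gam.
  by move=> Gp Gq; have [Gam' [st _]] := H _ (leqnn _) Gp Gq; exists Gam'.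
elim: n Gam => [|n IH] Gam Gn Gp Gq.
  have pG : p \in domf Gam by rewrite -fndSome Gp.
  by move: Gn pG; rewrite leqn0 cardfs_eq0 => /eqP ->; rewrite inE.
have [k /andP[kp kq]|others] :=
    pickP (fun k : domf Gam => (val k != p) && (val k != q)).
  have [|||Gam' [st dE]] := IH Gam.[~ val k].
  - have := cardfsD1 (val k) (domf Gam); rewrite (valP k) add1n domf_rem => e.
    by rewrite -ltnS -e.
  - by rewrite fnd_rem1 eq_sym kp.
  - by rewrite fnd_rem1 eq_sym kq.
  have kG : val k \notin domf Gam.[~ val k] by rewrite mem_remfF.
  exists Gam'.[val k <- Gam k]; split; last first.
    by rewrite !dom_setf dE domf_rem fsetD1K ?(valP k).
  rewrite -{1}[Gam](setf_get k) -setf_rem1.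
  by apply: step_frame => //; rewrite dE.
exists ([fmap].[p <- T1] + [fmap].[q <- T2]).
have dE X Y : domf ([fmap].[p <- X] + [fmap].[q <- Y] : env) = [fset p; q].
  by rewrite domf_cat !dom_setf domf0 !fsetU0.
have -> : Gam = [fmap].[p <- lsend q B1] + [fmap].[q <- lrecv p B2].
  apply/fmapP => k; rewrite fnd_cat !fnd_set fnd_fmap0 dom_setf domf0 fsetU0 inE.
  case: (k =P q) => [->|/eqP kq]; first by rewrite Gq.
  case: (k =P p) => [->|/eqP kp]; first by rewrite Gp.
  case: fndP => // kG; have := others [` kG]; by rewrite /= kp kq.
split; last by rewrite !dE.
have pqN X Y : fdisjoint (domf ([fmap].[p <- X] : env)) (domf ([fmap].[q <- Y] : env)).
  by rewrite !dom_setf domf0 !fsetU0 fdisjoint1X inE; apply/eqP.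
exact: step_comm (step_send _ _ B1l) (step_recv _ _ B2l) S12 (pqN _ _) (pqN _ _).
Qed.

(** * Association as an invariant of reduction *)

Lemma sub_send_inv q B U : subtype (lsend q B) U ->
  exists2 C, U = lsend q C & forall l S T, bget B l = Some (S, T) ->
    exists S' T', [/\ bget C l = Some (S', T'), subsort S S' & subtype T T'].
Proof. by move=> /subtype_inv h; inversion h as [|?|? ? C]; subst; exists C. Qed.

Lemma sub_recv_inv q B U : subtype (lrecv q B) U ->
  exists2 C, U = lrecv q C & forall l S' T', bget C l = Some (S', T') ->
    exists S T, [/\ bget B l = Some (S, T), subsort S' S & subtype T T'].
Proof. by move=> /subtype_inv h; inversion h as [|? ? C|?]; subst; exists C. Qed.

Lemma sub_lend_inv T : subtype T lend -> T = lend.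
Proof. by move=> /subtype_inv h; inversion h. Qed.

Lemma assoc_projectable Gam G : assoc Gam G -> projectable G.
Proof.
case=> hpt _ r; have [/hpt[T [U [_ ? _]]]|Gr] := classic (pt G r); first by exists U.
(* Absence of [r] passes to all continuations, so this relation is closed. *)
exists lend; exists (fun K T => ~ pt K r /\ T = lend); split=> // {Gr}.
move=> K T [Kr ->]; split=> //.
- by move=> p B e; case: Kr; rewrite e; exact: pt_receiver.
- by move=> p B e; case: Kr; rewrite e; exact: pt_sender.
- move=> p q B e _ _ l S K' Bl; split=> // K'r; case: Kr; rewrite e.
  exact: pt_cont Bl K'r.
Qed.

Lemma assoc_live_type Gam G r T : assoc Gam G -> Gam.[? r] = Some T ->
  T <> lend -> pt G r /\ exists2 U, proj r G U & subtype T U.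
Proof.
move=> [hpt hnpt] Gr T0.
have ptG : pt G r by apply: NNPP => /hnpt[]; rewrite Gr => // -[].
split=> //; have [T' [U [Gr' pU TU]]] := hpt _ ptG.
by move: Gr'; rewrite Gr => -[->]; exists U.
Qed.

Definition invariant Gam G : Prop := assoc Gam G /\ well_reaching G.

(** The sender drives the argument: subtyping puts [l] in the projection on [p], the distance to [p]
    yields a global step, and this step puts [l] in the projection on [q], where subtyping on
    receptions applies. *)
Lemma invariant_step Gam Gam' G p q l : invariant Gam G ->
  step Gam (acomm p q l) Gam' ->
  exists2 G', gstep p q l G G' & invariant Gam' G'.
Proof.
move=> [asG wG] st.
have [B1 [B2 [S1 [S2 [T1 [T2 [pq [Gp B1l] [Gq B2l] S12 [G'p G'q hG']]]]]]]] :=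
  step_comm_inv st erefl.
have [ptp [Up pUp /sub_send_inv[C1 ? hC1]]] := assoc_live_type asG Gp ltac:(by []).
have [ptq [Uq pUq /sub_recv_inv[C2 ? hC2]]] := assoc_live_type asG Gq ltac:(by []).
subst Up Uq.
have [S1' [U1 [C1l _ TU1]]] := hC1 _ _ _ B1l.
have [d dG] := wG G p (gsubtree_refl G) ptp.
have [G' GG'] := gstep_exists dG pUp pUq C1l.
have [S2' [U2 C2l]] := bdom_bget (gstep_recv_label GG' pUq).
have [S2'' [T2' [B2l' _ TU2]]] := hC2 _ _ _ C2l.
move: B2l'; rewrite B2l => -[? ?]; subst S2'' T2'.
have ap := lact_send p q C1l; have aq := lact_recv p q C2l.
have key r T U : Gam.[? r] = Some T -> proj r G U -> subtype T U ->
    exists T' U', [/\ Gam'.[? r] = Some T', proj r G' U' & subtype T' U'].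
  move=> Gr rU TU.
  have [->|/eqP rp] := eqVneq r p.
    by exists T1, U1; split=> //; exact: proj_gstep GG' pUp ap.
  have [->|/eqP rq] := eqVneq r q.
    by exists T2, U2; split=> //; exact: proj_gstep GG' pUq aq.
  exists T, U; split=> //; first by rewrite hG'.
  exact: proj_gstep GG' rU (lact_other _ _ rp rq).
exists G' => //; split; last first.
  exact: well_reaching_gstep GG' (assoc_projectable asG) wG pUp ap pUq aq.
have [hpt hnpt] := asG; split=> r G'r.
  have [T [U [Gr rU TU]]] := hpt _ (pt_gstep GG' G'r); exact: key Gr rU TU.
(* A participant that leaves the global type now projects to [lend], whose only subtype is [lend].
   One that was already absent is neither [p] nor [q], so its entry is unchanged. *)
have [/hpt[T [U [Gr rU TU]]]|Gr] := classic (pt G r).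
  have [T' [U' [-> rU' TU']]] := key _ _ _ Gr rU TU.
  by move: TU'; rewrite (proj_notin rU' G'r) => /sub_lend_inv ->; right.
rewrite hG'; [exact: hnpt| |] => e; apply: Gr; by rewrite e.
Qed.

(** * Progress along fair paths *)

Lemma root_enabled Gam a b B : assoc Gam (gcomm a b B) ->
  exists l, enabled Gam (acomm a b l).
Proof.
move=> [hpt _].
have [T1 [U1 [Ga aU1 TU1]]] := hpt a (pt_sender _ _ _).
have [T2 [U2 [Gb bU2 TU2]]] := hpt b (pt_receiver _ _ _).
have [C1 [? [dE hC1]]] := proj_sender aU1.
have [C2 [? [_ hC2]]] := proj_receiver bU2; subst U1 U2.
(* Were they equal, the projection on [a] would be both a send and a receive. *)
have ab : a <> b.
  move=> e; rewrite -e in aU1 bU2; have [? []] := proj_receiver aU1.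
  by [].
move: (subtype_inv TU1) (subtype_inv TU2) => h1 h2.
inversion h1 as [| |? B1 ? hB1]; inversion h2 as [|? B2 ? hB2|]; subst.
(* The label is taken from the actual type of the sender, which offers the fewest. It is followed
   through the sender's projection, the global node and the receiver's projection to the receiver's
   actual type, and the sorts compose. *)
have [l [S [T B1l]]] := branches_inhabited B1.
have [S' [T' [C1l SS' _]]] := hB1 _ _ _ B1l.
have [S0 [K Bl]] := bget_transfer (esym dE) C1l.
have [? []] := hC1 _ _ _ Bl; rewrite C1l => -[? _] _; subst S'.
have [T2' [C2l _]] := hC2 _ _ _ Bl.
have [S2 [T2 [B2l S02 _]]] := hB2 _ _ _ C2l.
by exists l; exact: step_comm_enabled ab Ga B1l Gb B2l (subsort_trans SS' S02).
Qed.

(* The interaction a participant r of type T is waiting for. *)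
Definition waits r T : option (part * part) :=
  match T with
  | lend => None
  | lrecv p _ => Some (p, r)
  | lsend q _ => Some (r, q)
  end.

(** Subtyping preserves direction and partner, so the actual type of [r] awaits the same pair as its
    projection. *)
Lemma waits_root Gam c e B r T a b : assoc Gam (gcomm c e B) -> r = c \/ r = e ->
  Gam.[? r] = Some T -> waits r T = Some (a, b) -> a = c /\ b = e.
Proof.
move=> [hpt _] rce Gr rT.
have [|T' [U []]] := hpt r.
  by case: rce => ->; [exact: pt_sender|exact: pt_receiver].
rewrite Gr => -[<-] rU /subtype_inv TU.
case: rce => ?; subst r.
  have [C [? _]] := proj_sender rU; subst U.
  by inversion TU; subst; case: rT => -> ->.
have [C [? _]] := proj_receiver rU; subst U.
by inversion TU; subst; case: rT => -> ->.
Qed.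

(** The type of [r] fixes its role and partner, so a communication involving [r] is the awaited
    one. *)
Lemma waits_step Gam Gam' p q l r T a b : step Gam (acomm p q l) Gam' ->
  Gam.[? r] = Some T -> waits r T = Some (a, b) ->
  (a = p /\ b = q) \/ [/\ r <> p, r <> q & Gam'.[? r] = Some T].
Proof.
move=> st Gr rT.
have [B1 [B2 [S1 [S2 [T1 [T2 [_ [Gp _] [Gq _] _ [_ _ hG']]]]]]]] :=
  step_comm_inv st erefl.
have [?|/eqP rp] := eqVneq r p.
  by subst r; move: Gr rT; rewrite Gp => -[<-] [-> ->]; left.
have [?|/eqP rq] := eqVneq r q.
  by subst r; move: Gr rT; rewrite Gq => -[<-] [-> ->]; left.
by right; rewrite hG'.
Qed.

Lemma eventually_comm_le (pi : @rpath part lab) m n p q : m <= n ->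
  eventually_comm pi n p q -> eventually_comm pi m p q.
Proof.
by move=> mn [k [l [nk vk e]]]; exists k, l; split=> //; exact: leq_trans mn nk.
Qed.

Lemma valid_step_le (pi : @rpath part lab) m n : m <= n ->
  valid_step pi n -> valid_step pi m.
Proof. by rewrite /valid_step; case: (plen pi) => // N; exact: leq_ltn_trans. Qed.

Lemma valid_stepS (pi : @rpath part lab) n : valid_step pi n -> valid_state pi n.+1.
Proof. by []. Qed.

Section FairPath.

Variable pi : @rpath part lab.
Hypotheses (pi_path : is_path pi) (pi_fair : fair_path pi).

(* Until r communicates, the distance d to its next occurrence in the global
   type never increases, and it drops when the root interaction fires, which
   fairness guarantees. *)
Lemma fair_waits d n G r T a b : valid_state pi n -> invariant (pstate pi n) G ->
  reaches d G r -> (pstate pi n).[? r] = Some T -> waits r T = Some (a, b) ->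
  eventually_comm pi n a b.
Proof.
elim: d n G => [|d IHd] n [|c e B] vn invG dG nr rT; try by case: dG => [[]|].
  case: dG => [rce|//]; have [l en] := root_enabled invG.1.
  by case: (waits_root invG.1 rce nr rT) => -> ->; exact: pi_fair vn _ _ _ en.
have [rce|rce] := classic (r = c \/ r = e).
  have [l en] := root_enabled invG.1.
  by case: (waits_root invG.1 rce nr rT) => -> ->; exact: pi_fair vn _ _ _ en.
have [l0 en] := root_enabled invG.1.
have [k [l1 [nk vk ek]]] := pi_fair vn en.
(* Inner induction on the number [j] of steps before the root communication that fairness promises
   at [k]. The root pair stays fixed while [n] and [B] vary. *)
have [j kE] : exists j, k = (n + j)%N by exists (k - n)%N; rewrite subnKC.
elim: j n B kE {vn en nk} invG dG nr => [|j IHj] n B kE invG dG nr;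
    have vn : valid_step pi n by apply: valid_step_le vk; rewrite kE leq_addr.
  rewrite addn0 in kE; subst k.
  have := pi_path vn; rewrite ek => st.
  have [[-> ->]|[rp rq n1r]] := waits_step st nr rT; first by exists n, l1.
  have [G' GG' invG'] := invariant_step invG st.
  (* The step at [k] carries the root pair, so it cannot be a context step, which would require
     [c <> c]. *)
  inversion GG' as [? S K Bl|? ? ? ? cc]; subst; last by case: cc.
  have [_ [<-] dK] := reaches_cont dG rp rq Bl.
  apply: eventually_comm_le (leqnSn n) _.
  exact: IHd (valid_stepS vn) invG' dK n1r rT.
case en : (plabel pi n) => [[p q] l].
have := pi_path vn; rewrite en => st.
have [[-> ->]|[rp rq n1r]] := waits_step st nr rT; first by exists n, l.
have [G' GG' invG'] := invariant_step invG st.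
apply: eventually_comm_le (leqnSn n) _.
have dG' := reaches_gstep rp rq GG' dG.
(* If the root fires before [k], the distance drops and the outer hypothesis applies; otherwise the
   root pair remains and [k] is one step closer. *)
inversion GG' as [? S K Bl|? ? ? B']; subst.
  have [_ [<-] dK] := reaches_cont dG rp rq Bl.
  exact: IHd (valid_stepS vn) invG' dK n1r rT.
by apply: IHj invG' dG' n1r; rewrite addSnnS.
Qed.

Lemma path_invariant n G : invariant (pstate pi 0) G -> valid_state pi n ->
  exists G', invariant (pstate pi n) G'.
Proof.
move=> inv0; elim: n => [|n IH] vn; first by exists G.
have vs : valid_step pi n by move: vn; rewrite /valid_step /valid_state; case: plen.
have [|G' invG'] := IH.
  by move: vs; rewrite /valid_step /valid_state; case: plen => // N /ltnW.
have := pi_path vs; case: (plabel pi n) => [[p q] l] st.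
by have [G'' _ ?] := invariant_step invG' st; exists G''.
Qed.

(** Sends and receives are treated together: each enabled action reveals a type with an awaited
    pair, hence a participant of the global type at a finite distance. *)
Lemma invariant_live_path G : invariant (pstate pi 0) G -> live_path pi.
Proof.
move=> inv0 n vn p q l S.
have [G' invG'] := path_invariant inv0 vn; have [asG' wG'] := invG'.
have key r T a b : (pstate pi n).[? r] = Some T -> waits r T = Some (a, b) ->
    eventually_comm pi n a b.
  move=> nr rT; have [|ptr _] := assoc_live_type asG' nr; first by move=> e; rewrite e in rT.
  have [d dG] := wG' G' r (gsubtree_refl G') ptr.
  exact: fair_waits vn invG' dG nr rT.
split=> -[Gam' st].
  by have [B [T [Gp _ _]]] := step_send_inv st erefl; exact: key Gp erefl.
by have [B [T [Gp _ _]]] := step_recv_inv st erefl; exact: key Gp erefl.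
Qed.

End FairPath.

Lemma red_star_invariant Gam Gam' G : invariant Gam G -> red_star Gam Gam' ->
  exists G', invariant Gam' G'.
Proof.
move=> + st; elim: st G => {Gam Gam'}
  [Gam Gam' [p [q [l st]]]|Gam|Gam1 Gam2 Gam3 _ IH1 _ IH2] G inv.
- by have [G' _ ?] := invariant_step inv st; exists G'.
- by exists G.
- by have [G' /IH2] := IH1 _ inv.
Qed.

End Liveness.

Theorem mainTheorem4 (part lab : choiceType) (Gam : env part lab) (G : gtt part lab) :
  wf_gtt G -> balanced G -> projectable G ->
  assoc Gam G -> live Gam.
Proof.
move=> _ balG _ asG Gam' st pi pi_path pi0 pi_fair.
have [G' inv'] := red_star_invariant (conj asG (balanced_well_reaching balG)) st.
by apply: (invariant_live_path pi_path pi_fair (G := G')); rewrite pi0.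
Qed.
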